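(* Let $X\subseteq\mathbb{R}^n$ be nonempty, closed and convex, let $Y\subseteq\mathbb{R}^m$ be closed, convex and unbounded, and let $O_X\supseteq X$ and $O_Y\supseteq Y$ be open sets. Let $g:\mathbb{R}^n\times\mathbb{R}^m\to\mathbb{R}$ be Lipschitz continuous and let $\{g_\mu:\mu>0\}$ be a family of smooth approximations of $g$ over $O_X\times O_Y$. Let $\{Y_\mu:\mu>0\}$ be a family of compact subsets of $Y$ with $\mathrm{vol}(Y_\mu)>0$ and $Y_\mu\nearrow Y$. Suppose that: (1) $g$ is level-bounded in $y$ locally uniformly in $x$; (2) for every open set $\Omega$ with $\mathrm{cl}(\Omega)\subseteq O_X$, $g_\mu\to g$ uniformly on $\mathrm{cl}(\Omega)\times Y$ as $\mu\searrow0$; (3) $\mu\ln\mathrm{vol}(Y_\mu)\to0$ as $\mu\searrow0$. Define $v(x)=\min_{y\in Y}g(x,y)$ and, for $\mu>0$ and $x\in O_X$, $$v_\mu^{\rm ent}(x)=-\mu\ln\Big(\int_{Y_\mu}\exp\big(-\mu^{-1}g_\mu(x,y)\big)\,dy\Big).$$ Then $\{v_\mu^{\rm ent}:\mu>0\}$ is a family of smooth approximations over $O_X$ of the value function $v$.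
   Context: $Y_\mu\nearrow Y$ means $Y_\mu\subseteq Y_{\mu'}\subseteq Y$ for all $0<\mu'<\mu$ and $\bigcup_{\mu>0}Y_\mu=Y$. Smooth approximations: for an open set $O\subseteq\mathbb{R}^d$ and a continuous function $\phi:O\to\mathbb{R}$, $\{\phi_\mu:\mu>0\}$ is a family of smooth approximations of $\phi$ over $O$ if each $\phi_\mu:O\to\mathbb{R}$ is continuously differentiable and for all $\bar z\in O$, $\lim_{z\to\bar z,\ \mu\searrow0}\phi_\mu(z)=\phi(\bar z)$. Level-boundedness: for each $x'\in\mathbb{R}^n$ and $M\in\mathbb{R}$ there is an open ball $B$ around $x'$ such that $\{(x,y):x\in B,\ g(x,y)\le M\}$ is bounded. $\mathrm{vol}$ is Lebesgue measure and $\mathrm{cl}$ is closure. *)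

(* Defs.v *)
From HB Require Import structures.
From mathcomp Require Import all_boot all_order all_algebra.
From mathcomp Require Import all_classical all_reals all_analysis.

Set Implicit Arguments.
Unset Strict Implicit.
Unset Printing Implicit Defensive.

Import Order.TTheory GRing.Theory Num.Theory.
Import numFieldNormedType.Exports.

Local Open Scope classical_set_scope.
Local Open Scope ring_scope.

(* R^m is 'rV[R]_m; its sigma-algebra is the product one (as for n.-tuple T in
   the library), which is the Borel sigma-algebra. *)

Section measurable_rV.
Context {R : realType} (m : nat).

Definition rV_coord (i : 'I_m) (v : 'rV[R]_m) : measurableTypeR R := v ord0 i.

Let rV_set0 : g_sigma_preimage rV_coord set0.
Proof. exact: sigma_algebra0. Qed.

Let rV_setC A : g_sigma_preimage rV_coord A -> g_sigma_preimage rV_coord (~` A).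
Proof. exact: sigma_algebraC. Qed.

Let rV_bigcup (F : (set 'rV[R]_m)^nat) :
  (forall i, g_sigma_preimage rV_coord (F i)) ->
  g_sigma_preimage rV_coord (\bigcup_i (F i)).
Proof. exact: sigma_algebra_bigcup. Qed.

HB.instance Definition _ := @isMeasurable.Build default_measure_display
  'rV[R]_m (g_sigma_preimage rV_coord) rV_set0 rV_setC rV_bigcup.

End measurable_rV.

Definition rV_cons {R : realType} (m : nat) (p : measurableTypeR R * 'rV[R]_m) :
    'rV[R]_m.+1 :=
  \row_i (if unlift ord0 i is Some j then p.2 ord0 j else p.1).

(* m-dimensional Lebesgue measure: the m-fold product of the Lebesgue measure
   on the line, R^m.+1 being identified with R * R^m through rV_cons. *)
Fixpoint lebesgue_rV {R : realType} (m : nat) : set 'rV[R]_m -> \bar R :=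
  match m with
  | 0 => dirac (0 : 'rV[R]_0)
  | k.+1 => pushforward (lebesgue_measure \x @lebesgue_rV R k)%E (@rV_cons R k)
  end.

Definition rV_uncons {R : realType} (m : nat) (v : 'rV[R]_m.+1) :
    measurableTypeR R * 'rV[R]_m :=
  (v ord0 ord0, \row_j v ord0 (lift ord0 j)).

Lemma rV_consK (R : realType) (m : nat) : cancel (@rV_cons R m) (@rV_uncons R m).
Proof.
move=> [x v]; congr pair; first by rewrite mxE unlift_none.
by apply/rowP => j; rewrite !mxE liftK.
Qed.

Lemma measurable_rV_coord (R : realType) (m : nat) (i : 'I_m) :
  measurable_fun [set: 'rV[R]_m] (@rV_coord R m i).
Proof.
move=> _ B mB; rewrite setTI; apply: sub_sigma_algebra; rewrite -bigcup_seq/=.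
by exists i => /=; [rewrite mem_index_enum|exists B => //; rewrite setTI].
Qed.

Lemma measurable_rVP d (T : measurableType d) (R : realType) (m : nat)
    (f : T -> 'rV[R]_m) :
  (forall i, measurable_fun setT (@rV_coord R m i \o f)) ->
  measurable_fun setT f.
Proof.
move=> mf.
suff H : g_sigma_preimage (fun i => @rV_coord R m i \o f) `<=` measurable.
  move=> _ A mA; rewrite setTI; apply: H.
  by rewrite g_sigma_preimage_comp; exists A => //; rewrite setTI.
apply: smallest_sub; first exact: sigma_algebra_measurable.
rewrite -bigcup_seq; apply: bigcup_sub => i _ A [B mB <-]; exact: mf.
Qed.

Lemma measurable_rV_cons (R : realType) (m : nat) :
  measurable_fun [set: measurableTypeR R * 'rV[R]_m] (@rV_cons R m).
Proof.
apply: measurable_rVP => j; rewrite /comp /rV_coord /rV_cons.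
case: (unliftP ord0 j) => [k|] ->.
- rewrite [X in measurable_fun _ X](_ : _ = @rV_coord R m k \o snd).
    exact: measurableT_comp (@measurable_rV_coord R m k) measurable_snd.
  by apply/funext => p /=; rewrite mxE liftK.
- rewrite [X in measurable_fun _ X](_ : _ = fst) //.
  by apply/funext => p /=; rewrite mxE unlift_none.
Qed.

Lemma measurable_rV_uncons (R : realType) (m : nat) :
  measurable_fun setT (@rV_uncons R m).
Proof.
apply: measurable_fun_pair; first exact: (@measurable_rV_coord R m.+1 ord0).
apply: measurable_rVP => j.
rewrite [X in measurable_fun _ X](_ : _ = @rV_coord R m.+1 (lift ord0 j)).
  exact: measurable_rV_coord.
by apply/funext => v; rewrite /= /rV_coord mxE.
Qed.

Section lebesgue_rV_measure.
Local Open Scope ereal_scope.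
Context {R : realType}.

Let lebesgue_rV_spec m :
  [/\ @lebesgue_rV R m set0 = 0,
      forall A, 0 <= @lebesgue_rV R m A,
      semi_sigma_additive (@lebesgue_rV R m) &
      sigma_finite setT (@lebesgue_rV R m)].
Proof.
elim: m => [|m [mu0 mu_ge0 mu_sigma mu_fin]].
  split; [exact: measure0|move=> A; exact: measure_ge0|
          exact: measure_semi_sigma_additive|].
  exists (fun=> setT) => [|i]; first by rewrite bigcup_const.
  by split => //; rewrite /= diracT ltry.
pose H1 := isMeasure.Build _ _ _ (@lebesgue_rV R m) mu0 mu_ge0 mu_sigma.
pose mu1 : {measure set 'rV[R]_m -> \bar R} := HB.pack (@lebesgue_rV R m) H1.
pose H2 := Measure_isSigmaFinite.Build _ _ _ mu1 mu_fin.
pose mu : {sigma_finite_measure set 'rV[R]_m -> \bar R} :=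
  HB.pack (Measure.sort mu1) H2.
have mf := @measurable_rV_cons R m.
split.
- exact: (measure0 (pushforward (lebesgue_measure \x mu) (@rV_cons R m))).
- by move=> A; apply: integral_ge0 => x _; exact: (measure_ge0 mu).
- move=> F mE tF mUF.
  have mpre A : measurable A -> measurable (@rV_cons R m @^-1` A).
    by move=> mA; rewrite -[X in measurable X]setTI; exact: mf.
  rewrite /= /pushforward preimage_bigcup.
  apply: (@measure_semi_sigma_additive _ _ _ (lebesgue_measure \x mu)).
  + by move=> k; exact: mpre.
  + apply/trivIsetP => /= i j _ _ ij; rewrite -preimage_setI.
    by move/trivIsetP : tF => /(_ _ _ _ _ ij) ->//; rewrite preimage_set0.
  + by rewrite -preimage_bigcup; exact: mpre.
- have /sigma_finiteP[F [FT ndF Ffin]] := sigma_finiteT (@lebesgue_measure R).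
  have /sigma_finiteP[G [GT ndG Gfin]] := sigma_finiteT mu.
  exists (fun k => @rV_uncons R m @^-1` (F k `*` G k)) => [|k].
    apply/esym; rewrite -subTset => v _.
    have [k _ Fk] : (\bigcup_k F k) (rV_uncons v).1 by rewrite -FT.
    have [l _ Gl] : (\bigcup_l G l) (rV_uncons v).2 by rewrite -GT.
    exists (maxn k l) => //; split.
    + by move: Fk; exact/subsetPset/ndF/leq_maxl.
    + by move: Gl; exact/subsetPset/ndG/leq_maxr.
  have [mFk Fkoo] := Ffin k; have [mGk Gkoo] := Gfin k.
  split.
    rewrite -[X in measurable X]setTI; apply: measurable_rV_uncons => //.
    exact: measurableX.
  rewrite /= /pushforward (_ : _ @^-1` _ = F k `*` G k); last first.
    rewrite -comp_preimage (_ : _ \o _ = id)//.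
    by apply/funext => p; rewrite /= rV_consK.
  by rewrite (product_measure1E _ mu)// lte_mul_pinfty// ge0_fin_numE.
Qed.

HB.instance Definition _ m := isMeasure.Build _ _ _ (@lebesgue_rV R m)
  (let: And4 h _ _ _ := lebesgue_rV_spec m in h)
  (let: And4 _ h _ _ := lebesgue_rV_spec m in h)
  (let: And4 _ _ h _ := lebesgue_rV_spec m in h).

HB.instance Definition _ m := Measure_isSigmaFinite.Build _ _ _
  (@lebesgue_rV R m) (let: And4 _ _ _ h := lebesgue_rV_spec m in h).

End lebesgue_rV_measure.

Lemma lebesgue_rV_box (R : realType) (m : nat)
    (A : 'I_m -> set (measurableTypeR R)) :
  (forall i, measurable (A i)) ->
  lebesgue_rV [set v : 'rV[R]_m | forall i, A i (v ord0 i)] =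
  (\prod_(i < m) lebesgue_measure (A i))%E.
Proof.
elim: m A => [|m IH] A mA.
  rewrite big_ord0 /= /dirac indicE mem_set// => -[]//.
rewrite big_ord_recl -IH//= /pushforward.
rewrite [X in (_ \x _)%E X](_ : _ = A ord0 `*`
    [set v : 'rV[R]_m | forall i, A (lift ord0 i) (v ord0 i)]).
  rewrite (product_measure1E _ (@lebesgue_rV R m))//.
  rewrite [X in measurable X](_ : _ =
      \bigcap_(i in [set: 'I_m]) (@rV_coord R m i @^-1` A (lift ord0 i))).
    apply: fin_bigcap_measurable; first exact: finite_finset.
    by move=> i _; rewrite -[X in measurable X]setTI; exact: measurable_rV_coord.
  by apply/seteqP; split => v /= H i; [move=> _; exact: H|exact: H].
apply/seteqP; split => [p /= H|p /= [H0 H] i].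
  split => [|i]; first by have := H ord0; rewrite mxE unlift_none.
  by have := H (lift ord0 i); rewrite mxE liftK.
by rewrite mxE; case: (unliftP ord0 i) => [j|] ->.
Qed.

(* Fréchet C^1: the derivative is continuous for the operator norm. Outside O
   the function is unconstrained. *)
Definition continuously_differentiable {R : realType} {V : normedModType R}
    (O : set V) (f : V -> R) : Prop :=
  (forall z, O z -> differentiable f z) /\
  (forall z0, O z0 -> forall eps : R, 0 < eps ->
    \forall z \near z0, forall h : V, `|'d f z h - 'd f z0 h| <= eps * `|h|).

Definition smooth_approximations {R : realType} {V : normedModType R}
    (O : set V) (phi : V -> R) (phi_ : R -> V -> R) : Prop :=
  [/\ open O,
      forall z, O z -> {for z, continuous phi},
      forall mu, 0 < mu -> continuously_differentiable O (phi_ mu) &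
      forall zbar, O zbar ->
        phi_ p.1 p.2 @[p --> filter_prod (0 : R)^'+ (nbhs zbar)] --> phi zbar].

Definition increases_to {R : realType} {T : Type} (Y_ : R -> set T) (Y : set T)
    : Prop :=
  (forall mu mu', 0 < mu' -> mu' < mu -> Y_ mu `<=` Y_ mu' /\ Y_ mu' `<=` Y) /\
  \bigcup_(mu in [set mu : R | 0 < mu]) Y_ mu = Y.

Definition level_bounded_locally_uniformly {R : realType} {n m : nat}
    (g : 'rV[R]_n * 'rV[R]_m -> R) : Prop :=
  forall (x' : 'rV[R]_n) (M : R), exists2 r : R, 0 < r &
    bounded_set [set z : 'rV[R]_n * 'rV[R]_m | ball x' r z.1 /\ g z <= M].

Definition value_function {R : realType} {n m : nat}
    (g : 'rV[R]_n * 'rV[R]_m -> R) (Y : set 'rV[R]_m) (x : 'rV[R]_n) : R :=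
  inf [set g (x, y) | y in Y].

Definition is_minimum {R : realType} {T : Type} (Y : set T) (f : T -> R) (a : R)
    : Prop :=
  (exists2 y, Y y & f y = a) /\ (forall y, Y y -> a <= f y).

Definition v_ent {R : realType} {n m : nat}
    (g_ : R -> 'rV[R]_n * 'rV[R]_m -> R) (Y_ : R -> set 'rV[R]_m)
    (mu : R) (x : 'rV[R]_n) : R :=
  - mu * ln (\int[lebesgue_rV (m := m)]_(y in Y_ mu) expR (- mu^-1 * g_ mu (x, y))).

(* Main.v *)
(* The integrand exp (- g_mu / mu) is C^1 and Y_mu is compact, so the partial
   differential in x is continuous uniformly in y by the tube lemma; the mean
   value theorem then allows differentiation under the integral sign, and
   composing with - mu * ln gives the smoothness of v_mu.

   For the limit at x0, fix l > 0.  Near x0 and for small mu, uniform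
   convergence gives g_mu >= v x0 - 2 l on Y_mu, hence
   v_mu >= v x0 - 2 l - mu ln (vol Y_mu).  Conversely, let y0 minimize g (x0, .)
   over Y.  A homothety centered at y0 contracts Y_1 into a compact set A of
   positive volume, contained in Y by convexity and as close to y0 as desired.
   Since Y_mu increases to Y, vol (Y_mu `&` A) >= c > 0 for small mu, and
   g_mu <= v x0 + 2 l on A, so v_mu <= v x0 + 2 l - mu ln c. *)

Require Import Defs.
From HB Require Import structures.
From mathcomp Require Import all_boot all_order all_algebra.
From mathcomp Require Import all_classical all_reals all_analysis.
From mathcomp Require Import measurable_realfun.
From mathcomp Require Import ring lra.

Set Implicit Arguments.
Unset Strict Implicit.

Import Order.TTheory GRing.Theory Num.Theory.
Import numFieldNormedType.Exports.

Local Open Scope classical_set_scope.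
Local Open Scope ring_scope.

(** * Borel sets, null sets and homotheties of [R^m] *)

(** The norm is the sup norm, so a ball is a finite intersection of preimages of intervals under the
    coordinates. *)
Lemma measurable_rV_ball (R : realType) (m : nat) (x : 'rV[R]_m) (r : R) :
  measurable (ball x r).
Proof.
have [r0|r0] := ltP 0 r; last first.
  rewrite (_ : ball x r = set0) => [|]; first exact: measurable0.
  by rewrite -subset0 => y [+ _]; rewrite ltNge r0.
have -> : ball x r = \bigcap_(i in [set: 'I_m])
    (@rV_coord R m i @^-1` ball (x ord0 i) r).
  apply/seteqP; split => [y [_ xy] i _|y xy]; first exact: xy.
  by split => // i j; rewrite (ord1 i); exact: xy.
apply: fin_bigcap_measurable => [|i _]; first exact: finite_finset.
rewrite -[X in measurable X]setTI; apply: measurable_rV_coord => //.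
apply: (@open_measurable R); exact: ball_open.
Qed.

(* Rational balls of radius 1/k are a countable base, so open sets belong to the
   product sigma-algebra. *)
Lemma open_measurable_rV (R : realType) (m : nat) (U : set 'rV[R]_m) :
  open U -> measurable U.
Proof.
move=> oU.
pose q2r (q : 'rV[rat]_m) : 'rV[R]_m := map_mx ratr q.
pose B (p : 'rV[rat]_m * nat) : set 'rV[R]_m := ball (q2r p.1) p.2.+1%:R^-1.
have -> : U = \bigcup_(p in [set: 'rV[rat]_m * nat])
    (if `[< B p `<=` U >] then B p else set0).
  apply/seteqP; split => [x Ux|x [p _]]; last first.
    by case: asboolP => // BU; exact: BU.
  have /nbhs_ballP[e /= e0 xeU] : nbhs x U by exact: open_nbhs_nbhs.
  have [k] : exists k : nat, k.+1%:R^-1 < e / 2.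
    have e20 : 0 < e / 2 by rewrite divr_gt0.
    by have [k] := ltr_add_invr e20; rewrite add0r; exists k.
  set d : R := k.+1%:R^-1 => de.
  have d0 : 0 < d by rewrite invr_gt0.
  have [q xq] : exists q : 'rV[rat]_m, ball x d (q2r q).
    have H j : {r : rat | ratr r \in `]x ord0 j - d, x ord0 j + d[%R}.
      apply/cid/rat_in_itvoo; rewrite ltrBlDr -addrA ltrDl.
      by rewrite addr_gt0.
    exists (\row_j sval (H j)); split => // i j; rewrite (ord1 i) !mxE.
    by rewrite ball_itv /=; exact: (svalP (H j)).
  exists (q, k) => //.
  case: asboolP => [_|nBU]; first exact: ball_sym.
  exfalso; apply: nBU => y qy; apply: xeU.
  rewrite (splitr e); apply: ball_triangle (le_ball (ltW de) xq) _.
  exact: (le_ball (ltW de) qy).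
apply: countable_bigcupT_measurable => [|p]; first exact: countableP.
by case: ifPn => // _; exact: measurable_rV_ball.
Qed.

Lemma compact_measurable_rV (R : realType) (m : nat) (K : set 'rV[R]_m) :
  compact K -> measurable K.
Proof.
move=> cK; rewrite -(setCK K); apply: measurableC; apply: open_measurable_rV.
by apply: closed_openC; exact: compact_closed.
Qed.

(** A bounded set lies in a cube, whose volume is given by [lebesgue_rV_box]. *)
Lemma compact_lebesgue_rV_lty (R : realType) (m : nat) (K : set 'rV[R]_m) :
  compact K -> (lebesgue_rV K < +oo)%E.
Proof.
move=> cK; have [M [_ KM]] := compact_bounded cK.
(* Boundedness provides a bound by every real above [M]; one is chosen that is nonnegative whatever
   the sign of [M]. *)
pose c : R := `|M| + 1.
have c0 : 0 <= c by rewrite addr_ge0.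
have {}KM x : K x -> `|x| <= c.
  by apply: KM; rewrite /c (le_lt_trans (ler_norm M))// ltrDl.
pose A (i : 'I_m) : set (measurableTypeR R) := `[- c, c]%classic.
have mA i : measurable (A i) by exact: measurable_itv.
have mB : measurable [set v : 'rV[R]_m | forall i, A i (v ord0 i)].
  rewrite (_ : [set _ | _] = \bigcap_(i in [set: 'I_m])
    (@rV_coord R m i @^-1` A i)).
    apply: fin_bigcap_measurable => [|i _]; first exact: finite_finset.
    by rewrite -[X in measurable X]setTI; exact: measurable_rV_coord.
  by apply/seteqP; split => [v H i _|v H i]; exact: H.
apply: (@le_lt_trans _ _
  (lebesgue_rV [set v : 'rV[R]_m | forall i, A i (v ord0 i)])).
  apply: le_measure; rewrite ?inE//; first exact: compact_measurable_rV.
  move=> v /KM vc i; rewrite /A /= in_itv /= -ler_norml.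
  by apply: le_trans vc; rewrite [leRHS]mx_normrE; exact: (le_bigmax _ _ (ord0, i)).
rewrite lebesgue_rV_box// (eq_bigr (fun=> (c + c)%:E)).
  rewrite big_const_ord; elim: m {K cK KM A mA mB} => [|m IH] /=; first by rewrite ltry.
  by rewrite lte_mul_pinfty// ?lee_fin ?addr_ge0.
move=> i _; rewrite lebesgue_measure_itv /= lte_fin.
case: ifPn => [_|]; first by rewrite opprK.
rewrite -leNgt => cc; have -> : c = 0 by apply/eqP; rewrite eq_le c0 andbT; lra.
by rewrite addr0.
Qed.

(** Uniqueness of Lebesgue measure: [t] times the image measure under the affine map gives half-open
    intervals their length. *)
Lemma lebesgue_measure_affine (R : realType) (t b : R)
    (A : set (measurableTypeR R)) : 0 < t -> measurable A ->
  (t%:E * lebesgue_measure ((fun x => t * x + b)%R @^-1` A))%E = lebesgue_measure A.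
Proof.
move=> t0 mA; pose f (x : measurableTypeR R) : measurableTypeR R := t * x + b.
have mf : measurable_fun setT f.
  by apply: measurable_funD => //; exact: measurable_funM.
pose f' : {mfun measurableTypeR R >-> measurableTypeR R} :=
  HB.pack f (@isMeasurableFun.Build _ _ _ _ f mf).
apply/esym.
apply: (lebesgue_measure_unique (mu := mscale (NngNum (ltW t0))
  (pushforward lebesgue_measure f'))) mA.
move=> _ [[a b']] _ <-.
rewrite [RHS](_ : _ = (t%:E * lebesgue_measure (f @^-1` `]a, b']%classic))%E)//.
rewrite (_ : f @^-1` _ = `](a - b) / t, (b' - b) / t]%classic); last first.
  apply/seteqP; split => x /=; rewrite !in_itv/= /f;
    by rewrite ltr_pdivrMr// ler_pdivlMr// (mulrC x) ltrBlDr lerBrDr.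
rewrite !lebesgue_measure_itv/= !lte_fin ltr_pM2r ?invr_gt0// ltrD2r.
case: ifPn => _; last by rewrite mule0.
rewrite -!EFinD -EFinM; congr EFin.
by field; rewrite gt_eqF.
Qed.

(* By induction on the dimension: slicing along the first coordinate
   commutes with the homothety. *)
Lemma lebesgue_rV_homothety_null (R : realType) (m : nat) (t : R)
    (b : 'rV[R]_m) (A : set 'rV[R]_m) : 0 < t -> measurable A ->
  lebesgue_rV A = 0%E -> lebesgue_rV ((fun v => t *: v + b) @^-1` A) = 0%E.
Proof.
move=> t0; elim: m b A => [|m IH] b A mA A0.
  rewrite (_ : _ @^-1` _ = A)//; apply/funext => v /=.
  by congr A; apply/rowP; case.
pose nu := @lebesgue_rV R m.
pose S (B : set 'rV[R]_m.+1) x := nu (xsection (@rV_cons R m @^-1` B) x).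
have mcons (B : set 'rV[R]_m.+1) : measurable B -> measurable (@rV_cons R m @^-1` B).
  by move=> mB; rewrite -[X in measurable X]setTI; exact: measurable_rV_cons.
have mS B : measurable B -> measurable_fun setT (S B).
  by move=> mB; apply: measurable_fun_xsection; exact: mcons.
have mh : measurable ((fun v : 'rV[R]_m.+1 => t *: v + b) @^-1` A).
  rewrite -[X in measurable X]setTI.
  apply: (@measurable_rVP _ _ _ _ (fun v : 'rV[R]_m.+1 => t *: v + b)) => // i.
  rewrite (_ : _ \o _ = fun v => t * rV_coord i v + b ord0 i); last first.
    by apply/funext => v; rewrite /= /rV_coord !mxE.
  apply: measurable_funD => //; apply: measurable_funM => //.
  exact: measurable_rV_coord.
(* The volume of [B] is the integral of its slice volumes [S B], so it vanishes exactly when almost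
   every slice is null. *)
have null B : measurable B ->
    lebesgue_rV B = 0%E <-> lebesgue_measure [set x | S B x != 0%E] = 0%E.
  move=> mB.
  have mS0 : measurable [set x | S B x != 0%E].
    by rewrite -[X in measurable X]setTI; apply: emeasurable_neq => //; exact: mS.
  have -> : lebesgue_rV B = (\int[lebesgue_measure]_x `|S B x|)%E.
    by apply: eq_integral => x _; rewrite gee0_abs// /S measure_ge0.
  rewrite ae_eq_integral_abs//; last exact: mS.
  split=> [H|H].
    apply/negligibleP => //; apply: (negligibleS _ H) => x /= Sx Sx0.
    by move/eqP: Sx; apply; exact: Sx0.
  exists [set x | S B x != 0%E]; split => // x /= /not_implyP[_ Sx].
  exact/eqP.
apply/null => //.
pose f (x : measurableTypeR R) : measurableTypeR R := t * x + b ord0 ord0.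
have mS0 : measurable [set x | S A x != 0%E].
  by rewrite -[X in measurable X]setTI; apply: emeasurable_neq => //; exact: mS.
have mfS0 : measurable (f @^-1` [set x | S A x != 0%E]).
  rewrite -[X in measurable X]setTI.
  have mf : measurable_fun setT f.
    by apply: measurable_funD => //; exact: measurable_funM.
  exact: mf.
(* By the slice identity and [IH], a non-null slice at [x] forces a non-null slice of [A] at [f x];
   such points form a null set, whose preimage under [f] is null by [lebesgue_measure_affine]. *)
apply: (@subset_measure0 _ _ _ lebesgue_measure _ (f @^-1` [set x | S A x != 0%E])) => //.
- by rewrite -[X in measurable X]setTI; apply: emeasurable_neq => //; exact: mS.
- move=> x /=; apply: contraNN => /eqP SA0; apply/eqP; rewrite /S /nu.
  have -> : xsection (@rV_cons R m @^-1` ((fun v => t *: v + b) @^-1` A)) x =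
      (fun v => t *: v + \row_j b ord0 (lift ord0 j)) @^-1`
      xsection (@rV_cons R m @^-1` A) (f x).
    rewrite !xsectionE; apply/seteqP; split => v /=; congr A;
      apply/rowP => j; rewrite !mxE; case: (unliftP ord0 j) => [k|] -> //=;
      by rewrite ?liftK ?unlift_none ?mxE//.
  by apply: IH => //; apply: measurable_xsection; exact: mcons.
- have N0 := (null A mA).1 A0.
  have := lebesgue_measure_affine (b ord0 ord0) t0 mS0.
  rewrite N0 => /eqP; rewrite mule_eq0 eqe gt_eqF//= => /eqP; exact.
Qed.

(** * Differentiation under the integral sign *)

Lemma cvg_pairr (U V : topologicalType) (x : U) (y : V) :
  (x, y') @[y' --> y] --> (x, y).
Proof. exact: (cvg_pair (cvg_cst x) cvg_id). Qed.

(** Chain rule. The outer function is only assumed differentiable at values taken by [f] on [O], so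
    that [ln] is allowed when [f] is positive there. *)
Lemma continuously_differentiable_comp (R : realType) (V : normedModType R)
    (O : set V) (f : V -> R) (psi dpsi : R -> R) :
  open O -> continuously_differentiable O f ->
  (forall z, O z -> is_derive (f z) 1 psi (dpsi (f z))) ->
  (forall z, O z -> {for f z, continuous dpsi}) ->
  continuously_differentiable O (psi \o f).
Proof.
move=> oO [df cdf] dpsiE cdpsi.
have dpsi_diff z : O z -> differentiable psi (f z).
  by move=> Oz; apply/derivable1_diffP; have [] := dpsiE _ Oz.
have dE z : O z -> forall h, 'd (psi \o f) z h = dpsi (f z) * 'd f z h.
  move=> Oz h; rewrite diff_comp//=; [|exact: df|exact: dpsi_diff].
  have [psi_derivable <-] := dpsiE _ Oz.
  by rewrite deriv1E// derive1E [LHS]mulrC.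
split => [z Oz|z0 Oz0 e e0].
  by apply: differentiable_comp; [exact: df|exact: dpsi_diff].
have [C C0 dfC] := linear_lipschitz (diff_continuous (df _ Oz0)).
(* This bounds [dpsi (f z)] for [z] near [z0], and is a positive denominator even if [dpsi (f z0)]
   vanishes. *)
have D0 : 0 < `|dpsi (f z0)| + 1 by rewrite ltr_wpDl.
have e10 : 0 < e / 2 / (`|dpsi (f z0)| + 1) by rewrite !divr_gt0.
have e20 : 0 < e / 2 / C by rewrite !divr_gt0.
have cf : {for z0, continuous f} by apply: differentiable_continuous; exact: df.
have cpf : dpsi (f z) @[z --> z0] --> dpsi (f z0).
  exact: (continuous_comp cf (cdpsi _ Oz0)).
have Oz : \forall z \near z0, O z by exact: open_nbhs_nbhs.
have d1 : \forall z \near z0, `|dpsi (f z) - dpsi (f z0)| < 1.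
  by move/cvgr_distC_lt : cpf => /(_ 1 ltr01).
have d2 : \forall z \near z0, `|dpsi (f z) - dpsi (f z0)| < e / 2 / C.
  by move/cvgr_distC_lt : cpf => /(_ _ e20).
apply: filterS3 Oz (filterI d1 d2) (cdf _ Oz0 _ e10) => z Oz [z1 z2] dz h.
rewrite !dE// (_ : _ - _ = dpsi (f z) * ('d f z h - 'd f z0 h) +
  (dpsi (f z) - dpsi (f z0)) * 'd f z0 h); last by ring.
rewrite (le_trans (ler_normD _ _))// !normrM (splitr e) mulrDl lerD//.
- apply: (@le_trans _ _ ((`|dpsi (f z0)| + 1) *
    (e / 2 / (`|dpsi (f z0)| + 1) * `|h|))).
    apply: ler_pM => //.
    rewrite -(subrK (dpsi (f z0)) (dpsi (f z))) (le_trans (ler_normD _ _))//.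
    by rewrite addrC lerD2l ltW.
  by rewrite mulrA [X in X * _]mulrC divfK// gt_eqF.
- apply: (@le_trans _ _ (e / 2 / C * (C * `|h|))).
    by apply: ler_pM => //; exact: ltW.
  by rewrite mulrA divfK// gt_eqF.
Qed.

(** A continuous function is bounded on [K], and [K] has finite volume. Continuity is taken in the
    whole space at the points of [K]. *)
Lemma integrable_compact_rV (R : realType) (m : nat) (K : set 'rV[R]_m)
    (f : 'rV[R]_m -> R) :
  compact K -> (forall y, K y -> {for y, continuous f}) ->
  (lebesgue_rV (m := m)).-integrable K (EFin \o f).
Proof.
move=> cK cf; have mK := compact_measurable_rV cK.
apply: measurable_bounded_integrable => //.
- exact: compact_lebesgue_rV_lty.
- move=> _; apply: (measurability _ (RGenOpens.measurableE R)) => // _ [_ [a [b ->] <-]].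
  (* By continuity, a point of [K] in the preimage is interior to it, so the preimage may be
     replaced by an open set. *)
  rewrite (_ : K `&` _ = K `&` (f @^-1` `]a, b[%classic)^°).
    by apply: measurableI => //; apply: open_measurable_rV; exact: open_interior.
  apply/seteqP; split => y [Ky By]; split => //; last exact: interior_subset By.
  by apply: cf => //; apply: open_nbhs_nbhs; split => //; exact: interval_open.
- have cfK : {within K, continuous f}.
    by apply: continuous_in_subspaceT => y /set_mem Ky; exact: cf.
  have := compact_bounded (continuous_compact cfK cK).
  move=> [M [Mreal HM]]; exists M; split => // x Mx y Ky /=.
  by apply: (HM _ Mx); exists y.
Qed.

(** Restriction to a line, to which the one-variable mean value theorem applies. *)
Lemma is_derive_line (R : realType) (V : normedModType R) (f : V -> R)
    (p v : V) (t : R) : differentiable f (p + t *: v) ->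
  is_derive t 1 (fun s => f (p + s *: v)) ('d f (p + t *: v) v).
Proof.
move=> df.
have E : (fun h : R => h^-1 *: (((fun s => f (p + s *: v)) \o shift t) (h *: 1) -
      f (p + t *: v))) =
    (fun h : R => h^-1 *: ((f \o shift (p + t *: v)) (h *: v) - f (p + t *: v))).
  apply/funext => h /=; congr (_ *: (f _ - _)).
  by rewrite scalerDl addrCA [_ *: 1]mulr1.
split; first by rewrite /derivable E; exact: diff_derivable.
by rewrite /derive E -deriveE.
Qed.

(** * Partial differential in the first variable, uniformly over a compact set *)

Section partial_differential.
Context (R : realType) (U W : normedModType R).
Variables (O : set U) (OY K : set W) (phi : U * W -> R).
Hypotheses (oO : open O) (cK : compact K) (KOY : K `<=` OY).
Hypothesis C1 : continuously_differentiable (O `*` OY) phi.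

Lemma continuous_snd_arg x y : O x -> OY y ->
  {for y, continuous (fun y => phi (x, y))}.
Proof.
move=> Ox Oy.
have cp : (x, y') @[y' --> y] --> (x, y) by exact: cvg_pairr.
exact: (continuous_comp cp (differentiable_continuous (C1.1 (x, y) (conj Ox Oy)))).
Qed.

Lemma continuous_diff_snd_arg x y k : O x -> OY y ->
  {for y, continuous (fun y => 'd phi (x, y) k)}.
Proof.
move=> Ox Oy.
apply/cvgrPdistC_le => /= e e0.
have k0 : 0 < `|k| + 1 by rewrite ltr_wpDl.
have C1xy := C1.2 (x, y) (conj Ox Oy) (e / (`|k| + 1)) (divr_gt0 e0 k0).
have C1y : \forall y' \near y, forall h, `|'d phi (x, y') h - 'd phi (x, y) h| <=
    e / (`|k| + 1) * `|h| by exact: (cvg_pairr C1xy).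
apply: (@filterS _ (nbhs y) (nbhs_filter y) _ _ _ C1y) => y' dy.
apply: (le_trans (dy k)).
by rewrite mulrAC ler_pdivrMr// ler_pM2l// lerDl.
Qed.

(** Tube lemma: since [K] is compact, estimates near each [(x0, y)] combine into one neighbourhood
    of [x0]. *)
Lemma diff_near_uniform x0 (e : R) : O x0 -> 0 < e ->
  \forall x \near x0, forall y, K y ->
    forall k, `|'d phi (x, y) k - 'd phi (x0, y) k| <= e * `|k|.
Proof.
move=> Ox0 e0; have /compact_near_coveringP nK := cK.
apply: (nK _ (nbhs x0) (fun x y => forall k,
  `|'d phi (x, y) k - 'd phi (x0, y) k| <= e * `|k|)) => y Ky.
have e20 : 0 < e / 2 by rewrite divr_gt0.
have := C1.2 (x0, y) (conj Ox0 (KOY Ky)) (e / 2) e20.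
move=> [[/= A B] [Ax0 By] AB]; exists (B, A) => // -[y' x] [/= By' Ax] k.
(* Both [(x, y')] and [(x0, y')] are compared with [(x0, y)], at a cost of [e / 2] each. *)
have H1 := AB (x, y') (conj Ax By') k.
have H2 := AB (x0, y') (conj (nbhs_singleton Ax0) By') k.
rewrite /= in H1 H2.
rewrite -(subrKA ('d phi (x0, y) k)) (le_trans (ler_normD _ _))//.
rewrite (splitr e) mulrDl; apply: lerD; first exact: H1.
by rewrite distrC; exact: H2.
Qed.

(** The same covering argument, with the bound tending to infinity as parameter: near [y], a bound
    for the differential at [(x0, y)] increased by 1 suffices. *)
Lemma diff_uniformly_bounded x0 : O x0 -> exists2 C, 0 <= C &
  forall y, K y -> forall k, `|'d phi (x0, y) k| <= C * `|k|.
Proof.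
move=> Ox0; have /compact_near_coveringP nK := cK.
have : \forall C \near (+oo)%R, K `<=` (fun y => forall k,
    `|'d phi (x0, y) k| <= C * `|k|).
  apply: nK => y Ky.
  have [C C0 dC] := linear_lipschitz (diff_continuous (C1.1 (x0, y) (conj Ox0 (KOY Ky)))).
  have H : \forall y' \near y, forall k, `|'d phi (x0, y') k - 'd phi (x0, y) k| <= 1 * `|k|.
    exact: (cvg_pairr (C1.2 (x0, y) (conj Ox0 (KOY Ky)) 1 ltr01)).
  exists ([set y' | forall k, `|'d phi (x0, y') k - 'd phi (x0, y) k| <= 1 * `|k|],
      [set C' | C + 1 <= C']) => /=.
    by split; [exact: H|apply: nbhs_pinfty_ge; exact: num_real].
  move=> [y' C'] /= [Hy' HC'] k.
  rewrite -(subrK ('d phi (x0, y) k) ('d phi (x0, y') k)).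
  rewrite (le_trans (ler_normD _ _))// (le_trans (lerD (Hy' k) (dC k)))//.
  by rewrite -mulrDl ler_wpM2r// addrC.
move=> [M [Mreal HM]]; exists (`|M| + 1); first by rewrite addr_ge0.
by apply: HM; rewrite (le_lt_trans (ler_norm M))// ltrDl.
Qed.

(** Mean value theorem on the segment from [x0] to [x0 + h] with [y] fixed; the differential at the
    intermediate point is close to that at [x0], uniformly in [y]. *)
Lemma partial_increment_near_uniform x0 (e : R) : O x0 -> 0 < e ->
  \forall h \near (0 : U), forall y, K y ->
    `|phi (h + x0, y) - (phi (x0, y) + 'd phi (x0, y) (h, 0))| <= e * `|h|.
Proof.
move=> Ox0 e0.
have Onbhs : \forall x \near x0, O x by exact: open_nbhs_nbhs.
have : \forall x \near x0, O x /\ forall y, K y ->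
    forall k, `|'d phi (x, y) k - 'd phi (x0, y) k| <= e * `|k|.
  exact: filterI Onbhs (diff_near_uniform Ox0 e0).
move=> /nbhs_ballP[r /= r0 ball_r].
apply/nbhs_ballP; exists r => //= h; rewrite -ball_normE /= sub0r normrN => hr y Ky.
have inball (t : R) : 0 <= t <= 1 -> ball x0 r (x0 + t *: h).
  move=> /andP[t0 t1]; rewrite -ball_normE /= opprD addNKr normrN normrZ ger0_norm//.
  by rewrite (le_lt_trans _ hr)// ler_piMl.
pose q (t : R) := phi ((x0, y) + t *: (h, 0)).
have qE (t : R) : (x0, y) + t *: (h, 0) = (x0 + t *: h, y).
  by congr pair => /=; rewrite scaler0 addr0.
have diffq (t : R) : 0 <= t <= 1 -> is_derive t 1 q ('d phi (x0 + t *: h, y) (h, 0)).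
  move=> t01; rewrite -qE; apply: is_derive_line; rewrite qE.
  by apply: C1.1; split; [exact: (ball_r _ (inball _ t01)).1|exact: KOY].
have [t|t|c cE] := @MVT_segment R q (fun t => 'd phi (x0 + t *: h, y) (h, 0)) 0 1 ler01.
- by rewrite in_itv /= => /andP[t0 t1]; apply: diffq; rewrite !ltW.
- apply: derivable_within_continuous => s; rewrite in_itv /= => s01.
  by have [] := diffq s s01.
rewrite /q !qE scale1r scale0r addr0 subr0 mulr1 => qE'.
rewrite opprD addrA (addrC h) qE'.
have c01 : 0 <= c <= 1 by move: cE; rewrite in_itv.
rewrite (le_trans ((ball_r _ (inball c c01)).2 y Ky (h, 0)))//.
by rewrite prod_normE /= normr0 max_l.
Qed.

End partial_differential.

Section derivative_under_integral.
Context (R : realType) (U : normedModType R) (m : nat).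
Variables (O : set U) (OY K : set 'rV[R]_m) (phi : U * 'rV[R]_m -> R).
Hypotheses (oO : open O) (cK : compact K) (KOY : K `<=` OY).
Hypothesis C1 : continuously_differentiable (O `*` OY) phi.

Local Notation mu := (lebesgue_rV (m := m)).
Local Notation F := (fun x => \int[mu]_(y in K) phi (x, y)).

Let mK : measurable K := compact_measurable_rV cK.

Let intphi x : O x -> mu.-integrable K (fun y => (phi (x, y))%:E).
Proof.
move=> Ox; apply: (integrable_compact_rV cK) => y Ky.
exact: (continuous_snd_arg C1 Ox (KOY Ky)).
Qed.

Let intdphi x k : O x -> mu.-integrable K (fun y => ('d phi (x, y) k)%:E).
Proof.
move=> Ox; apply: (integrable_compact_rV cK) => y Ky.
exact: (continuous_diff_snd_arg C1 Ox (KOY Ky)).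
Qed.

(** Candidate for the differential of [F] at [x0]; the vector [(h, 0)] selects the partial
    differential in the first variable. *)
Let L x0 h := \int[mu]_(y in K) 'd phi (x0, y) (h, 0).

Let volK := fine (mu K).
Let volK0 : 0 <= volK. Proof. exact: fine_ge0. Qed.

Let norm_int (f : 'rV[R]_m -> R) (c : R) : mu.-integrable K (EFin \o f) ->
  (forall y, K y -> `|f y| <= c) -> `|\int[mu]_(y in K) f y| <= c * volK.
Proof.
move=> If fc; rewrite (le_trans (le_normr_Rintegral mK If))//.
rewrite /volK -Rintegral_cst//; apply: le_Rintegral => //.
- exact: integrable_norm.
- by apply: integrable_compact_rV => // y _; exact: cst_continuous.
Qed.

Let L_linear x0 : O x0 -> linear (L x0).
Proof.
move=> Ox0 a h k; rewrite /L -[RHS]/(a * _ + _) -RintegralZl//; last exact: intdphi.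
rewrite -RintegralD//; [|apply: integrable_compact_rV => // y Ky|exact: intdphi].
  apply: eq_Rintegral => y _; rewrite -linearP; congr ('d phi _ _).
  by congr pair => /=; rewrite scaler0 addr0.
apply: continuousM; first exact: cst_continuous.
exact: (continuous_diff_snd_arg C1 Ox0 (KOY Ky)).
Qed.

(** [L x0] is bounded by [C * volK], hence continuous, and the uniform increment estimate integrates
    to a remainder [o(h)]; uniqueness of the differential concludes. *)
Let L_diff x0 : O x0 -> differentiable F x0 /\ forall h, 'd F x0 h = L x0 h.
Proof.
move=> Ox0.
pose L' : {linear U -> R} :=
  HB.pack (L x0) (GRing.isLinear.Build _ _ _ _ _ (L_linear Ox0)).
have [C C0 HC] := diff_uniformly_bounded cK KOY C1 Ox0.
have L'c : continuous L'.
  apply: bounded_linear_continuous; apply/linear_boundedP.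
  exists (C * volK) => /=.
  split => // r Cr h; rewrite (le_trans (norm_int (c := C * `|h|) _ _))//.
  - exact: intdphi.
  - move=> y Ky; rewrite (le_trans (HC y Ky _))// ler_wpM2l//.
    by rewrite prod_normE /= normr0 max_l.
  - by rewrite mulrAC ler_wpM2r// ltW.
have FL : F \o shift x0 = cst (F x0) + L' +o_ (0 : U) id.
  apply/eqaddoP => e e0.
  (* A pointwise error [e / (volK + 1) * |h|] integrates to at most [e * |h|]; the added 1 covers
     the case of a null [K]. *)
  have v0 : 0 < volK + 1 by rewrite ltr_wpDl.
  have /= Onbhs : \forall h \near (0 : U), O (h + x0).
    have : (h + x0) @[h --> (0 : U)] --> x0.
      rewrite -[X in _ --> X]add0r; apply: cvgD; [exact: cvg_id|exact: cvg_cst].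
    by apply; exact: open_nbhs_nbhs.
  near=> h.
  have Oh : O (h + x0) by near: h.
  rewrite /= -[X in `|X|]/(F (h + x0) - (F x0 + L x0 h)).
  rewrite /L -RintegralD//; [|exact: intphi|exact: intdphi].
  rewrite -RintegralB//; [|exact: intphi|].
    rewrite (le_trans (norm_int (c := e / (volK + 1) * `|h|) _ _))//.
    + exact: (integrableB mK (intphi Oh)
        (integrableD mK (intphi Ox0) (intdphi (h, 0) Ox0))).
    + near: h; apply: (partial_increment_near_uniform oO cK KOY C1) => //; exact: divr_gt0.
    + rewrite mulrAC ler_wpM2r//.
      by rewrite mulrAC ler_pdivrMr// ler_pM2l// lerDl.
  exact: (integrableD mK (intphi Ox0) (intdphi (h, 0) Ox0)).
have dFE := diff_unique L'c FL.
by split => [|h]; [apply/diff_locallyP; rewrite dFE|rewrite dFE].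
Unshelve. all: by end_near. Qed.

Lemma continuously_differentiable_integral : continuously_differentiable O F.
Proof.
split => [x Ox|x0 Ox0 e e0]; first exact: (L_diff Ox).1.
have v0 : 0 < volK + 1 by rewrite ltr_wpDl.
have Onbhs : \forall x \near x0, O x by exact: open_nbhs_nbhs.
apply: filterS2 Onbhs (diff_near_uniform cK KOY C1 Ox0 (divr_gt0 e0 v0)) => x Ox dx h.
rewrite (L_diff Ox).2 (L_diff Ox0).2 /L -RintegralB//; [|exact: intdphi|exact: intdphi].
rewrite (le_trans (norm_int (c := e / (volK + 1) * `|h|) _ _))//.
- exact: (integrableB mK (intdphi (h, 0) Ox) (intdphi (h, 0) Ox0)).
- move=> y Ky; rewrite (le_trans (dx y Ky _))// ler_wpM2l//; first by rewrite ltW// divr_gt0.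
  by rewrite prod_normE /= normr0 max_l.
- rewrite mulrAC ler_wpM2r//.
  by rewrite mulrAC ler_pdivrMr// ler_pM2l// lerDl.
Qed.

End derivative_under_integral.

(** * The value function and Laplace bounds *)

(** The constant is made positive because radii are later divided by it. *)
Lemma lipschitz_constant (R : realType) (V W : normedModType R) (f : V -> W) :
  lipschitz f -> exists2 k, 0 < k & forall x y, `|f x - f y| <= k * `|x - y|.
Proof.
move=> [M [_ fM]]; exists (`|M| + 1) => [|x y]; first by rewrite ltr_wpDl.
have MM : M < `|M| + 1 by rewrite (le_lt_trans (ler_norm M))// ltrDl.
exact: (fM _ MM (x, y)).
Qed.

Lemma uniform_near (R : realType) (T : choiceType) (A : set T)
    (F : R -> T -> R) (f : T -> R) (e : R) :
  {uniform A, F mu @[mu --> 0^'+] --> f} -> 0 < e ->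
  \forall mu \near 0^'+, forall x, A x -> `|f x - F mu x| < e.
Proof.
move=> Ff e0; apply: (Ff [set h | forall x, A x -> `|f x - h x| < e]).
apply/uniform_nbhs; exists [set xy : R * R | ball xy.1 e xy.2]; split.
  exact: (@entourage_ball _ R (PosNum e0)).
by move=> h /= fh x /fh; rewrite -ball_normE.
Qed.

Lemma inf_image_minimum (R : realType) (T : Type) (Y : set T) (f : T -> R)
    (y0 : T) :
  Y y0 -> (forall y, Y y -> f y0 <= f y) -> inf [set f y | y in Y] = f y0.
Proof.
move=> Yy0 fmin; apply/eqP; rewrite eq_le; apply/andP; split.
  by apply: ge_inf; [exists (f y0) => _ [y Yy <-]; exact: fmin|exists y0].
by apply: lb_le_inf => [|_ [y Yy <-]]; [exists (f y0), y0|exact: fmin].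
Qed.

(** Level-boundedness makes the part of [Y] where [g (x, .)] is at most [g (x, y0)] compact; a
    minimizer there is a minimizer over all of [Y]. *)
Lemma value_function_minimum (R : realType) (n m : nat)
    (g : 'rV[R]_n * 'rV[R]_m -> R) (Y : set 'rV[R]_m) (x : 'rV[R]_n) :
  Y !=set0 -> closed Y -> continuous g -> level_bounded_locally_uniformly g ->
  is_minimum Y (fun y => g (x, y)) (value_function g Y x).
Proof.
move=> [y0 Yy0] clY cg lbg.
have cgx : continuous (fun y => g (x, y)).
  by move=> y; exact: (continuous_comp (@cvg_pairr _ _ x y) (cg (x, y))).
pose S := Y `&` (fun y => g (x, y)) @^-1` [set s | s <= g (x, y0)].
have Sy0 : S y0 by split => //=.
have cS : compact S.
  apply: bounded_closed_compact; last first.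
    apply: closedI => //; apply: preimage_closed => [y _|]; first exact: cgx.
    exact: closed_le.
  have [r r0 [M [Mreal HM]]] := lbg x (g (x, y0)).
  exists M; split => // N MN y [_ /= gy].
  have := HM N MN (x, y) (conj (ballxx x r0) gy).
  by apply: le_trans; rewrite prod_normE le_max lexx orbT.
have [c /set_mem[Yc _] cmin] : exists2 c, c \in S &
    forall t, t \in S -> g (x, c) <= g (x, t).
  apply: compact_EVT_min => //; first by exists y0.
  exact: continuous_subspaceT.
have {}cmin y : Y y -> g (x, c) <= g (x, y).
  move=> Yy; have [yy0|/ltW y0y] := leP (g (x, y)) (g (x, y0)).
    by apply: cmin; apply/mem_set; split.
  by rewrite (le_trans _ y0y)//; apply: cmin; apply/mem_set.
have vE : value_function g Y x = g (x, c) by exact: (inf_image_minimum Yc cmin).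
by rewrite vE; split => //; exists c.
Qed.

(** [Y] does not depend on [x], so a minimizer for [x'] is a competitor for [x]; exchanging the two
    points gives the other inequality. *)
Lemma value_function_lipschitz (R : realType) (n m : nat)
    (g : 'rV[R]_n * 'rV[R]_m -> R) (Y : set 'rV[R]_m) (k : R) :
  (forall z w, `|g z - g w| <= k * `|z - w|) ->
  (forall x, is_minimum Y (fun y => g (x, y)) (value_function g Y x)) ->
  forall x x', `|value_function g Y x - value_function g Y x'| <= k * `|x - x'|.
Proof.
move=> gk vmin.
have H x x' : value_function g Y x - value_function g Y x' <= k * `|x - x'|.
  have [[y' Yy' <-] _] := vmin x'; have [_ vx] := vmin x.
  rewrite (le_trans (lerB (vx _ Yy') (lexx _)))// (le_trans (ler_norm _))//.
  by rewrite (le_trans (gk _ _))// prod_normE /= subrr normr0 max_l.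
move=> x x'; rewrite ler_norml H andbT lerNl opprB distrC.
exact: H.
Qed.

Section laplace_bounds.
Context d (T : measurableType d) (R : realType) (nu : {measure set T -> \bar R}).
Variables (D : set T) (f : T -> R) (s : R).
Hypotheses (mD : measurable D) (Doo : (nu D < +oo)%E) (s0 : 0 < s).
Local Notation E := (fun y => expR (- s^-1 * f y)).
Hypothesis intE : nu.-integrable D (EFin \o E).

Let integrable_cst (B : set T) (c : R) : measurable B -> B `<=` D ->
  nu.-integrable B (EFin \o (fun=> c)).
Proof.
move=> mB BD; apply: measurable_bounded_integrable => //.
  by rewrite (le_lt_trans _ Doo)// le_measure ?inE.
by exists `|c|; split => // x cx y _ /=; exact: ltW.
Qed.

Lemma Rintegral_expR_ge (B : set T) (b : R) :
  measurable B -> B `<=` D -> (forall y, B y -> f y <= b) ->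
  expR (- s^-1 * b) * fine (nu B) <= \int[nu]_(y in D) E y.
Proof.
move=> mB BD fb; rewrite -Rintegral_cst//.
have intEB : nu.-integrable B (EFin \o E) by exact: integrableS intE.
apply: (@le_trans _ _ (\int[nu]_(y in B) E y)).
  apply: le_Rintegral => //; first exact: integrable_cst.
  by move=> y By; rewrite ler_expR ler_nM2l ?fb// oppr_lt0 invr_gt0.
apply: fine_le; [exact: integrable_fin_num|exact: integrable_fin_num|].
by apply: ge0_subset_integral => //; have /integrableP[] := intE.
Qed.

Lemma Rintegral_expR_le (a : R) : (forall y, D y -> a <= f y) ->
  \int[nu]_(y in D) E y <= expR (- s^-1 * a) * fine (nu D).
Proof.
move=> fa; rewrite -Rintegral_cst//; apply: le_Rintegral => //.
  exact: integrable_cst.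
by move=> y Dy; rewrite ler_expR ler_nM2l ?fa// oppr_lt0 invr_gt0.
Qed.

(** [c] is kept apart from the measure of [B], so that [B] may vary with [s] while [s * ln c] still
    tends to 0. *)
Lemma ln_Rintegral_expR_le (B : set T) (b c : R) :
  measurable B -> B `<=` D -> (forall y, B y -> f y <= b) ->
  0 < c -> c <= fine (nu B) ->
  - s * ln (\int[nu]_(y in D) E y) <= b - s * ln c.
Proof.
move=> mB BD fb c0 cB.
have I1 : expR (- s^-1 * b) * c <= \int[nu]_(y in D) E y.
  by rewrite (le_trans _ (Rintegral_expR_ge mB BD fb))// ler_pM2l// expR_gt0.
have ec0 : 0 < expR (- s^-1 * b) * c by rewrite mulr_gt0// expR_gt0.
rewrite mulNr lerNl opprB lerBlDr.
have -> : s * ln c = s * ln (expR (- s^-1 * b) * c) + b.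
  rewrite lnM ?posrE ?expR_gt0// expRK; field; exact: lt0r_neq0.
by rewrite lerD2r ler_pM2l// ler_ln ?posrE// (lt_le_trans ec0).
Qed.

(** Positivity of the integral forces [D] to have positive measure, so both logarithms have positive
    arguments. *)
Lemma ln_Rintegral_expR_ge (a : R) : (forall y, D y -> a <= f y) ->
  0 < \int[nu]_(y in D) E y ->
  a - s * ln (fine (nu D)) <= - s * ln (\int[nu]_(y in D) E y).
Proof.
move=> fa I0; have I1 := Rintegral_expR_le fa.
have D0 : 0 < fine (nu D).
  by have := lt_le_trans I0 I1; rewrite pmulr_rgt0// expR_gt0.
rewrite mulNr lerNr opprB lerBrDr.
have -> : s * ln (fine (nu D)) = s * ln (expR (- s^-1 * a) * fine (nu D)) + a.
  rewrite lnM ?posrE ?expR_gt0// expRK; field; exact: lt0r_neq0.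
by rewrite lerD2r ler_pM2l// ler_ln ?posrE// (lt_le_trans I0).
Qed.

End laplace_bounds.

(** * Compact pieces of positive volume near a given point *)

(** If [c] bounds the distances from [y] to the points of [K], the ratio [r / (c + r)] brings them
    all within [r] of [y]; being at most 1, it keeps them in [Y] by convexity. *)
Lemma homothety_convex_ball (R : realType) (V : normedModType R) (Y K : set V)
    (y : V) (r : R) : convex_set (Y : set (convex_lmodType V)) ->
  compact K -> K `<=` Y -> Y y -> 0 < r ->
  exists2 t, 0 < t &
    (fun w => t *: w + (1 - t) *: y) @` K `<=` Y `&` ball y r.
Proof.
move=> cvxY cK KY Yy r0.
have [M [_ KM]] := compact_bounded cK.
pose c := `|M| + 1 + `|y|.
have c0 : 0 <= c by rewrite !addr_ge0.
have Kc w : K w -> `|w - y| <= c.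
  move=> Kw; rewrite (le_trans (ler_normB _ _))// lerD2r KM//.
  by rewrite (le_lt_trans (ler_norm M))// ltrDl.
have cr : 0 < c + r by rewrite ltr_wpDl.
have t0 : 0 < r / (c + r) by rewrite divr_gt0.
have t1 : r / (c + r) <= 1 by rewrite ler_pdivrMr// mul1r lerDr.
exists (r / (c + r)) => // _ [w Kw <-]; split.
  have := cvxY w y (Itv01 (ltW t0) t1) (mem_set (KY _ Kw)) (mem_set Yy).
  by move=> /set_mem.
rewrite -ball_normE /=; set t := r / _ in t0 t1 *.
rewrite (_ : y - _ = t *: (y - w)); last first.
  rewrite scalerBr scalerBl scale1r opprD opprB addrCA.
  by rewrite [y + _]addrC subrK addrC.
rewrite normrZ (gtr0_norm t0) distrC.
rewrite (le_lt_trans (ler_wpM2l (ltW t0) (Kc _ Kw)))//.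
by rewrite /t mulrAC ltr_pdivrMr// ltr_pM2l// ltrDl.
Qed.

(* A compact piece of positive volume is contracted towards [y] by a homothety,
   which stays inside the convex set [Y]. *)
Lemma positive_volume_near (R : realType) (m : nat) (Y K : set 'rV[R]_m)
    (y : 'rV[R]_m) (r : R) : convex_set (Y : set (convex_lmodType 'rV[R]_m)) ->
  compact K -> K `<=` Y -> (0 < lebesgue_rV K)%E -> Y y -> 0 < r ->
  exists A, [/\ compact A, A `<=` Y `&` ball y r & (0 < lebesgue_rV A)%E].
Proof.
move=> cvxY cK KY K0 Yy r0.
have [t t0 Kt] := homothety_convex_ball cvxY cK KY Yy r0.
pose h (w : 'rV[R]_m) := t *: w + (1 - t) *: y.
have ch : continuous h.
  by move=> w; apply: continuousD; [exact: scaler_continuous|exact: cst_continuous].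
have cA : compact (h @` K).
  by apply: continuous_compact => //; exact: continuous_subspaceT.
exists (h @` K); split => //.
(* Were the image null, so would be [K], its preimage under the homothety. *)
rewrite lt_neqAle measure_ge0 andbT eq_sym; apply/eqP => A0.
have := lebesgue_rV_homothety_null ((1 - t) *: y) t0 (compact_measurable_rV cA) A0.
rewrite (_ : _ @^-1` _ = K) => [K00|]; first by move: K0; rewrite K00 ltxx.
apply/seteqP; split => [w [w' Kw' /addIr /(scalerI (lt0r_neq0 t0)) <-]//|w Kw].
by exists w.
Qed.

(** By monotonicity the sets [Y_ (q k)] already cover [A]. Countably many null sets cannot, so some
    [Y_ (q k)] meets [A] in positive volume, and smaller parameters only enlarge it. *)
Lemma increasing_family_volume (R : realType) (m : nat) (Y A : set 'rV[R]_m)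
    (Y_ : R -> set 'rV[R]_m) :
  (forall mu, 0 < mu -> compact (Y_ mu)) -> increases_to Y_ Y ->
  compact A -> A `<=` Y -> (0 < lebesgue_rV A)%E ->
  exists2 c : R, 0 < c & \forall mu \near 0^'+,
    c <= fine (lebesgue_rV (Y_ mu `&` A)).
Proof.
move=> cY [Ymono YE] cA AY A0.
pose B mu := Y_ mu `&` A.
have mA := compact_measurable_rV cA.
have mB mu : 0 < mu -> measurable (B mu).
  by move=> mu0; apply: measurableI => //; apply: compact_measurable_rV; exact: cY.
have Bfin mu : 0 < mu -> lebesgue_rV (B mu) \is a fin_num.
  move=> mu0; rewrite ge0_fin_numE//.
  rewrite (le_lt_trans _ (compact_lebesgue_rV_lty cA))// le_measure ?inE//.
    exact: mB.
  exact: subIsetr.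
pose q (k : nat) : R := k.+1%:R^-1.
have q0 k : 0 < q k by rewrite invr_gt0.
have [k Bk] : exists k, lebesgue_rV (B (q k)) != 0%E.
  apply: contrapT => /forallNP BE.
  have : (lebesgue_rV (m := m)).-negligible (\bigcup_k B (q k)).
    apply: negligible_bigcup => k; apply/negligibleP; first exact: mB.
    by apply/eqP; have /negP := BE k; rewrite negbK.
  rewrite (_ : \bigcup_k _ = A) => [/negligibleP|].
    by move=> /(_ mA) A00; move: A0; rewrite A00 ltxx.
  apply/seteqP; split => [v [k _ []]//|v Av].
  have : Y v by exact: AY.
  rewrite -YE => -[mu /= mu0 Ymu].
  have [k] := ltr_add_invr mu0; rewrite add0r => kmu.
  by exists k => //; split => //; exact: (Ymono mu (q k) (q0 k) kmu).1.
exists (fine (lebesgue_rV (B (q k)))).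
  by rewrite fine_gt0// lt0e Bk measure_ge0 /= -ge0_fin_numE// Bfin.
near=> mu.
have mu0 : 0 < mu by near: mu; exact: nbhs_right_gt.
have muk : mu < q k by near: mu; exact: nbhs_right_lt.
apply: fine_le; [exact: Bfin|exact: Bfin|].
apply: le_measure; rewrite ?inE; [exact: mB|exact: mB|].
by apply: setSI; exact: (Ymono (q k) mu mu0 muk).1.
Unshelve. all: by end_near. Qed.

(** * The entropic approximation *)

Lemma open_prod (T U : topologicalType) (A : set T) (B : set U) :
  open A -> open B -> open (A `*` B).
Proof.
rewrite !openE => oA oB [x y] [/= Ax By].
by exists (A, B) => //; split; [exact: oA|exact: oB].
Qed.

Lemma lipschitz_constant_continuous (R : realType) (V W : normedModType R)
    (f : V -> W) (k : R) : 0 < k ->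
  (forall x y, `|f x - f y| <= k * `|x - y|) -> continuous f.
Proof.
move=> k0 fk x; apply/cvgrPdist_le => /= e e0.
have : \forall t \near x, `|x - t| <= e / k.
  by move/cvgrPdist_le : (@cvg_id _ (nbhs x)); apply; exact: divr_gt0.
apply: filterS => t xt; rewrite (le_trans (fk _ _))//.
by rewrite mulrC -ler_pdivlMr.
Qed.

Section entropic_approximation.
Context (R : realType) (n m : nat).
Variables (O_X : set 'rV[R]_n) (O_Y K : set 'rV[R]_m).
Variables (f : 'rV[R]_n * 'rV[R]_m -> R) (mu : R).
Hypotheses (oO_X : open O_X) (oO_Y : open O_Y) (cK : compact K) (KO_Y : K `<=` O_Y).
Hypotheses (K0 : (0 < lebesgue_rV K)%E) (mu0 : 0 < mu).
Hypothesis C1f : continuously_differentiable (O_X `*` O_Y) f.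

Local Notation E := (fun z => expR (- mu^-1 * f z)).
Local Notation nu := (lebesgue_rV (m := m)).

Let C1E : continuously_differentiable (O_X `*` O_Y) E.
Proof.
apply: (continuously_differentiable_comp (psi := fun s => expR (- mu^-1 * s))
  (dpsi := fun s => expR (- mu^-1 * s) * (- mu^-1)) _ C1f).
- exact: open_prod.
- move=> z _.
  have dl : is_derive (f z) 1 (fun s => - mu^-1 * s) (- mu^-1).
    rewrite -[X in is_derive _ _ _ X]mulr1.
    exact: (is_deriveZ (- mu^-1) (is_derive_id (f z) 1)).
  exact: (is_derive1_comp (is_derive_expR _) dl).
- move=> z _; apply: continuousM; last exact: cst_continuous.
  apply: continuous_comp; last exact: continuous_expR.
  exact: scaler_continuous.
Qed.

Lemma integrable_expR_compact x : O_X x ->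
  nu.-integrable K (fun y => (E (x, y))%:E).
Proof.
move=> Ox; apply: (integrable_compact_rV cK) => y Ky.
exact: (continuous_snd_arg C1E Ox (KO_Y Ky)).
Qed.

(** [f (x, .)] has a maximum on [K], so the integrand is bounded below by a positive constant on a
    set of positive volume. *)
Lemma Rintegral_expR_gt0 x : O_X x -> 0 < \int[nu]_(y in K) E (x, y).
Proof.
move=> Ox; have K_neq0 : K !=set0.
  by apply/set0P/eqP => K00; move: K0; rewrite K00 measure0 ltxx.
have [b _ bmax] : exists2 b, b \in K & forall y, y \in K -> f (x, y) <= f (x, b).
  apply: (compact_EVT_max (f := fun y => f (x, y))) => //.
  apply: continuous_in_subspaceT => y /set_mem Ky.
  exact: (continuous_snd_arg C1f Ox (KO_Y Ky)).
have Koo := compact_lebesgue_rV_lty cK; have mK := compact_measurable_rV cK.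
apply: lt_le_trans (Rintegral_expR_ge mK Koo mu0 (integrable_expR_compact Ox)
  (b := f (x, b)) mK (@subset_refl _ K) _).
  by rewrite mulr_gt0 ?expR_gt0// fine_gt0// K0 Koo.
by move=> y Ky; apply: bmax; exact: mem_set.
Qed.

(** The chain rule is applied on both sides of the integral: to the exponential inside, and to the
    logarithm outside, where positivity of the integral avoids its singularity. *)
Lemma continuously_differentiable_log_integral : continuously_differentiable O_X
  (fun x => - mu * ln (\int[nu]_(y in K) E (x, y))).
Proof.
have C1I := continuously_differentiable_integral oO_X cK KO_Y C1E.
apply: (continuously_differentiable_comp (psi := fun s => - mu * ln s)
  (dpsi := fun s => - mu * s^-1) oO_X C1I) => x Ox.
  have I0 := Rintegral_expR_gt0 Ox.
  exact: (is_deriveZ (- mu) (is_derive1_ln I0)).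
have I0 := Rintegral_expR_gt0 Ox.
apply: continuousM; first exact: cst_continuous.
by apply: inv_continuous; exact: lt0r_neq0.
Qed.

End entropic_approximation.

Theorem theorem4p17 (R : realType) (n m : nat)
    (X O_X : set 'rV[R]_n) (Y O_Y : set 'rV[R]_m)
    (g : 'rV[R]_n * 'rV[R]_m -> R)
    (g_ : R -> 'rV[R]_n * 'rV[R]_m -> R)
    (Y_ : R -> set 'rV[R]_m)
    (X_nonempty : X !=set0) (X_closed : closed X) (X_convex : convex_set X)
    (Y_closed : closed Y) (Y_convex : convex_set Y)
    (Y_unbounded : ~ bounded_set Y)
    (O_X_open : open O_X) (X_sub : X `<=` O_X)
    (O_Y_open : open O_Y) (Y_sub : Y `<=` O_Y)
    (g_lipschitz : lipschitz g)
    (g_smooth : smooth_approximations (O_X `*` O_Y) g g_)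
    (Y_compact : forall mu, 0 < mu -> compact (Y_ mu) /\ Y_ mu `<=` Y)
    (Y_vol : forall mu, 0 < mu -> (0 < lebesgue_rV (Y_ mu))%E)
    (Y_increases : increases_to Y_ Y)
    (g_level_bounded : level_bounded_locally_uniformly g)
    (g_uniform : forall Omega : set 'rV[R]_n,
       open Omega -> closure Omega `<=` O_X ->
       {uniform closure Omega `*` Y, g_ mu @[mu --> 0^'+] --> g})
    (vol_growth :
       mu * ln (fine (lebesgue_rV (Y_ mu))) @[mu --> 0^'+] --> 0) :
  (forall x, is_minimum Y (fun y => g (x, y)) (value_function g Y x)) /\
  smooth_approximations O_X (value_function g Y) (v_ent g_ Y_).
Proof.
have [k k0 gk] := lipschitz_constant g_lipschitz.
have Y_neq0 : Y !=set0.
  apply/set0P/eqP => Y0; apply: Y_unbounded; rewrite Y0.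
  by exists 0; split => // ? _ ? [].
have cg := lipschitz_constant_continuous k0 gk.
have vmin x : is_minimum Y (fun y => g (x, y)) (value_function g Y x).
  exact: value_function_minimum.
split => //.
have vlip := value_function_lipschitz gk vmin.
set v := value_function g Y in vmin vlip *.
have C1 mu : 0 < mu -> continuously_differentiable (O_X `*` O_Y) (g_ mu).
  by move=> mu0; have [_ _ + _] := g_smooth; exact.
have Y_O mu : 0 < mu -> Y_ mu `<=` O_Y.
  by move=> mu0; apply: subset_trans Y_sub; exact: (Y_compact mu mu0).2.
split => //.
- by move=> x _; exact: lipschitz_constant_continuous k0 vlip x.
- move=> mu mu0; have [cYmu _] := Y_compact mu mu0.
  exact: (continuously_differentiable_log_integral O_X_open O_Y_open cYmu
    (Y_O mu mu0) (Y_vol mu mu0) mu0 (C1 mu mu0)).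
move=> x0 Ox0.
apply/(@cvgrPdist_le _ _ _ _ (filter_prod_filter _ (nbhs_filter x0))) => /= e e0.
(* Each of the two bounds below loses at most [3 * l]. *)
pose l := e / 4; have l0 : 0 < l by rewrite divr_gt0.
have [[y0 Yy0 gy0] _] := vmin x0.
(* With Lipschitz constant [k], moving both [x] and [y] by less than [l / k] changes [g] by at most
   [l], the product norm being a maximum. *)
have [A [cA AYball A0]] : exists A, [/\ compact A, A `<=` Y `&` ball y0 (l / k)
    & (0 < lebesgue_rV A)%E].
  apply: (positive_volume_near Y_convex (K := Y_ 1)) => //.
  - by have [] := Y_compact 1 ltr01.
  - by have [] := Y_compact 1 ltr01.
  - exact: Y_vol.
  - exact: divr_gt0.
have AY : A `<=` Y by move=> y /AYball[].
have [c c0 cYA] := increasing_family_volume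
  (fun (mu : R) (mu0 : 0 < mu) => (Y_compact mu mu0).1) Y_increases cA AY A0.
have [r r0 rO] : exists2 r, 0 < r & ball x0 r `<=` O_X.
  have /nbhs_ballP[r r0 rO] : nbhs x0 O_X by exact: open_nbhs_nbhs.
  by exists r.
(* Halving the radius keeps the closure of [Omega] inside [O_X], as the uniform convergence
   hypothesis demands. *)
have r20 : 0 < r / 2 by rewrite divr_gt0.
pose Omega := ball x0 (r / 2).
have OmegaO : closure Omega `<=` O_X.
  apply: subset_trans rO; apply: closed_ball_subset => //.
  by rewrite ltr_pdivrMr// ltr_pMr// ltr1n.
have oOmega : open Omega by exact: ball_open.
have gunif := uniform_near (g_uniform Omega oOmega OmegaO) l0.
have lnc : \forall mu \near (0 : R)^'+, `|mu * ln c| <= l.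
  have : mu * ln c @[mu --> (0 : R)^'+] --> 0.
    rewrite -[X in _ --> X](mul0r (ln c)); apply: cvgMr_tmp.
    by apply: cvg_within_filter; exact: cvg_id.
  move/cvgrPdist_le => /(_ l l0); apply: filterS => mu /=.
  by rewrite sub0r normrN.
have lnvol : \forall mu \near (0 : R)^'+, `|mu * ln (fine (lebesgue_rV (Y_ mu)))| <= l.
  move/cvgrPdist_le : vol_growth => /(_ l l0); apply: filterS => mu /=.
  by rewrite sub0r normrN.
(* The product filter needs separate conditions on [mu] and on [x]; those on [mu] are uniform over
   [closure Omega]. *)
exists ([set mu | [/\ 0 < mu, c <= fine (lebesgue_rV (Y_ mu `&` A)),
    (forall z, (closure Omega `*` Y) z -> `|g z - g_ mu z| < l),
    `|mu * ln c| <= l & `|mu * ln (fine (lebesgue_rV (Y_ mu)))| <= l]],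
  Omega `&` ball x0 (l / k)) => /=.
  split; last by apply: filterI; apply: nbhsx_ballx => //; exact: divr_gt0.
  near=> mu; split; near: mu => //.
  exact: nbhs_right_gt.
move=> [mu x] /= [[mu0 cmu gmu lnc1 lnv1] [Omx xx0]].
have clOx : closure Omega x by exact: subset_closure.
have Ox : O_X x by exact: OmegaO.
have [cYmu YmuY] := Y_compact mu mu0.
have mYmu := compact_measurable_rV cYmu.
have Ymuoo := compact_lebesgue_rV_lty cYmu.
have intE := integrable_expR_compact mu O_X_open O_Y_open cYmu (Y_O mu mu0)
  (C1 mu mu0) Ox.
have I0 := Rintegral_expR_gt0 O_X_open O_Y_open cYmu (Y_O mu mu0)
  (Y_vol mu mu0) mu0 (C1 mu mu0) Ox.
have vx : `|v x0 - v x| <= l.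
  rewrite (le_trans (vlip _ _))// mulrC -ler_pdivlMr// ltW//.
  by move: xx0; rewrite -ball_normE.
(* On [Y_ mu], [g_ mu (x, .)] exceeds [g (x, .) - l], hence [v x - l]. *)
have lower : v x - l - mu * ln (fine (lebesgue_rV (Y_ mu))) <= v_ent g_ Y_ mu x.
  apply: (ln_Rintegral_expR_ge mYmu Ymuoo mu0 intE _ I0) => y Yy.
  have [_ /(_ y (YmuY _ Yy)) gxy] := vmin x.
  have := gmu (x, y) (conj clOx (YmuY _ Yy)).
  rewrite ltr_norml => /andP[_]; move: gxy; rewrite -/v; lra.
(* Only the part of the integral over [A] is kept: there [g] is within [l] of [g (x0, y0) = v x0],
   and [g_ mu] within [l] of [g]. *)
have upper : v_ent g_ Y_ mu x <= v x0 + l + l - mu * ln c.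
  have mA : measurable (Y_ mu `&` A).
    by apply: measurableI => //; exact: compact_measurable_rV.
  apply: (ln_Rintegral_expR_le mYmu Ymuoo mu0 intE mA (@subIsetl _ _ _) _ c0 cmu).
  move=> y [Yy /AYball[_ yy0]].
  have := gmu (x, y) (conj clOx (YmuY _ Yy)).
  rewrite ltr_norml => /andP[+ _].
  have : `|g (x, y) - g (x0, y0)| <= l.
    rewrite (le_trans (gk _ _))// mulrC -ler_pdivlMr// prod_normE /= ge_max.
    move: xx0 yy0; rewrite -!ball_normE /= => /ltW + /ltW.
    by rewrite !(distrC x0) !(distrC y0) => -> ->.
  rewrite ler_norml gy0 -/v => /andP[_]; lra.
move: vx lnc1 lnv1 lower upper; rewrite !ler_norml.
move=> /andP[? ?] /andP[? ?] /andP[? ?] ? ?.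
have le4 : e = l * 4 by rewrite /l divfK.
apply/andP; split; lra.
Unshelve. all: by end_near. Qed.
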